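(* Let $\Pi=(X,U,F,G,g)$ be an optimal control problem with value function $V$ such that $X$ is a proper metric space, $U$ is a compact metric space, $F$ is compact-valued, and $g$, $G$ and $F$ are upper semi-continuous. For every $i\in\mathbb{N}$, let $\Pi_i=(X_i,U_i,F_i,G_i,g_i)$ be an abstraction of conservatism $\rho_i\in\mathbb{R}_+\cup\{\infty\}$ of $\Pi$, let $C_i$ be an optimal controller for $\Pi_i$, and let $L_i$ be the closed-loop value function of $\Pi$ associated with $C_i\circ\mathop{\in}$, where $\mathop{\in}\colon X\rightrightarrows X_i$ is the membership relation. Suppose $\lim_{i\to\infty}\rho_i=0$. Then the sequence $(L_i)_{i\in\mathbb{N}}$ hypo-converges to $V$.
   Context: Conventions: $\mathbb{R}_+=[0,\infty)$, $\mathbb{Z}_+=\{0,1,2,\dots\}$, $\mathbb{N}=\{1,2,\dots\}$; $\infty+x=\infty$ for $x\in\mathbb{R}$; $\sup\emptyset=0$; $A^B$ is the set of maps $B\to A$. A set-valued map $f\colon A\rightrightarrows B$ assigns to each $a\in A$ a subset $f(a)\subseteq B$ and is identified with the relation $\{(a,b): b\in f(a)\}$; it is strict if $f(a)\neq\emptyset$ for all $a$. Images of sets are written $f(C)=\bigcup_{a\in C}f(a)$, and similarly for several arguments, e.g. $F_1(\Omega,u)=\bigcup_{p\in\Omega}F_1(p,u)$, $g_1(\Omega,\Omega',u)=\{g_1(p,p',u):p\in\Omega,p'\in\Omega'\}$. In a metric space $(X,d)$, $B(c,r)$ and $\bar B(c,r)$ are the open and closed balls, with $\bar B(c,0)=\{c\}$;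 for a set $M$, $B(M,r)=\bigcup_{c\in M}B(c,r)$ and $\bar B(M,r)=\bigcup_{c\in M}\bar B(c,r)$; $d(M,N)=\inf\{d(x,y):x\in M,y\in N\}$; $\operatorname{diam}$ is the diameter. A metric space is proper if every closed ball is compact. For $f\colon X\to[-\infty,\infty]$, $\operatorname{hypo}f=\{(x,\gamma)\in X\times\mathbb{R}:\gamma\le f(x)\}$; $X\times\mathbb{R}$ carries the product (maximum) metric. $f$ is upper semi-continuous if $\operatorname{hypo}f$ is closed; a set-valued $f\colon A\rightrightarrows B$ between metric spaces is upper semi-continuous if $\{a: f(a)\cap\Omega\neq\emptyset\}$ is closed for every closed $\Omega\subseteq B$. System: a triple $(X,U,F)$ with nonempty sets $X,U$ and strict $F\colon X\times U\rightrightarrows X$. A pair $(u,x)\in U^{\mathbb{Z}_+}\times X^{\mathbb{Z}_+}$ is a solution of it if $x(t+1)\in F(x(t),u(t))$ for all $t\in\mathbb{Z}_+$. Controller for $(X,U,F)$: a quintuple $C=(Z,Z_0,\widetilde X,\widetilde U,H)$ of nonempty sets $Z,Z_0,\widetilde X,\widetilde U$ with $Z_0\subseteq Z$, $X\subseteq\widetilde X$, $\widetilde U\subseteq U$, and a strict map $H\colon Z\times\widetilde X\rightrightarrows Z\times\widetilde U\times\{0,1\}$. A quadruple $(u,v,z,x)\in\widetilde U^{\mathbb{Z}_+}\times\{0,1\}^{\mathbb{Z}_+}\times Z^{\mathbb{Z}_+}\times\widetilde X^{\mathbb{Z}_+}$ is a solution of $C$ if $z(0)\in Z_0$ and $(z(t+1),u(t),v(t))\in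 H(z(t),x(t))$ for all $t\in\mathbb{Z}_+$. $\mathcal{F}(X,U)$ denotes the collection of all controllers for $(X,U,F)$. Behavior: for a system $S=(X,U,F)$ and $C\in\mathcal{F}(X,U)$, $\mathcal{B}(C\times S)$ is the set of $(u,v,x)\in(U\times\{0,1\}\times X)^{\mathbb{Z}_+}$ for which there is $z\colon\mathbb{Z}_+\to Z$ such that $(u,v,z,x)$ is a solution of $C$ and $(u,x)$ is a solution of $S$; $\mathcal{B}_p(C\times S)=\{(u,v,x)\in\mathcal{B}(C\times S): x(0)=p\}$. Optimal control problem: a tuple $(X,U,F,G,g)$ where $(X,U,F)$ is a system, $G\colon X\to\mathbb{R}_+\cup\{\infty\}$ (terminal cost) and $g\colon X\times X\times U\to\mathbb{R}_+\cup\{\infty\}$ (running cost). Its cost functional $J\colon(U\times\{0,1\}\times X)^{\mathbb{Z}_+}\to[0,\infty]$ is $J(u,v,x)=G(x(T))+\sum_{t=0}^{T-1}g(x(t),x(t+1),u(t))$ if $v\neq0$, where $T=\min v^{-1}(1)$, and $J(u,v,x)=\infty$ if $v=0$. With $S=(X,U,F)$, the closed-loop value function associated with $C\in\mathcal{F}(X,U)$ is $L(p)=\sup_{(u,v,x)\in\mathcal{B}_p(C\times S)}J(u,v,x)$, and the value function is $V(p)=\inf_{C\in\mathcal{F}(X,U)}\sup_{(u,v,x)\in\mathcal{B}_p(C\times S)}J(u,v,x)$. A controller $C\in\mathcal{F}(X,U)$ is optimal for the problem if the closed-loop value function associated with $C$ coincides with the value function. Serial composition: for a controller $C=(Z,Z_0,\widetilde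 X,\widetilde U,H)$, a nonempty set $X'$ and a strict map $Q\colon X'\rightrightarrows\widetilde X$, $C\circ Q$ is the controller $(Z,Z_0,X',\widetilde U,H')$ with $H'(z,x')=\bigcup_{y\in Q(x')}H(z,y)$. Abstraction: let $\Pi_i=(X_i,U_i,F_i,G_i,g_i)$, $i=1,2$, be optimal control problems, where $X_2$ is a cover of $X_1$ (a set of subsets of $X_1$ with union $X_1$) by non-empty subsets. $\Pi_2$ is an abstraction of $\Pi_1$ if the membership relation $Q=\mathop{\in}\colon X_1\rightrightarrows X_2$, $\mathop{\in}(p)=\{\Omega\in X_2:p\in\Omega\}$, is a valuated feedback refinement relation from $\Pi_1$ to $\Pi_2$, i.e. $Q$ is strict and for all $(p_1,p_2),(q_1,q_2)\in Q$ and $u\in U_2$: $U_2\subseteq U_1$; $G_1(p_1)\le G_2(p_2)$; $g_1(p_1,q_1,u)\le g_2(p_2,q_2,u)$; $Q(F_1(p_1,u))\subseteq F_2(p_2,u)$. Conservatism: let $\Pi_2$ be an abstraction of $\Pi_1$, let $U_1,X_1$ be metric spaces ($d$ the metric on $X_1$), and let the elements of $X_2$ be closed subsets of $X_1$. Then $\Pi_2$ is an abstraction of conservatism $\infty$ of $\Pi_1$. It is an abstraction of conservatism $\rho\in\mathbb{R}_+$ of $\Pi_1$ if for all $\Omega,\Omega'\in X_2$ and $u\in U_2$: (i) $U_1=\bar B(U_2,\rho)$; (ii) $G_2(\Omega)\le\rho+\sup G_1(\Omega)$; (iii) $g_2(\Omega,\Omega',u)\le\rho+\sup g_1(\Omega,\Omega',u)$;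 and, if $\Omega$ satisfies $G_1(\Omega)\cup g_1(\Omega,X_1,U_1)\neq\{\infty\}$, additionally (iv) $F_2(\Omega,u)\subseteq\{\Omega''\in X_2: d(\Omega'',F_1(\Omega,u))\le\rho\}$; (v) $\operatorname{diam}(\Omega)\le\rho$. Hypo-convergence: let $V\colon X\to\mathbb{R}_+\cup\{\infty\}$ be upper semi-continuous on the metric space $X$ and let $L_i\colon X\to\mathbb{R}_+\cup\{\infty\}$ satisfy $L_i\ge V$ for all $i\in\mathbb{N}$. $(L_i)_{i\in\mathbb{N}}$ hypo-converges to $V$ if for every $p\in X$ and every $\varepsilon>0$ there exists a neighborhood $N\subseteq X$ of $p$ such that $(N\times\mathbb{R})\cap\operatorname{hypo}L_i\subseteq B(\operatorname{hypo}V,\varepsilon)$ for all sufficiently large $i\in\mathbb{N}$. (That $V$ is upper semi-continuous and $L_i\ge V$ is part of what is asserted.) *)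

(* Defs.v *)
From HB Require Import structures.
From mathcomp Require Import all_boot all_order all_algebra.
From mathcomp Require Import all_classical all_reals all_analysis.

Set Implicit Arguments.
Unset Strict Implicit.
Unset Printing Implicit Defensive.

Import Order.TTheory GRing.Theory Num.Theory.
Import numFieldNormedType.Exports.

Local Open Scope classical_set_scope.
Local Open Scope ring_scope.

Section set_valued_maps.
Context {A B : Type}.

Definition strict_on (D : set A) (f : A -> set B) : Prop :=
  forall a, D a -> f a !=set0.

Definition strict (f : A -> set B) : Prop := strict_on setT f.

End set_valued_maps.

(* The state set of a system is a type X.  Its input set is a subset of a type
   T, so that inclusions between the input sets of different systems are
   literal; the data of a system at inputs outside that subset is junk and is
   never constrained nor used. *)
Record system (X T : Type) := System {
  inputs : set T ;
  trans : X -> T -> set X }.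

Section systems.
Context {X T : Type}.
Implicit Type S : system X T.

Definition is_system S : Prop :=
  [/\ [set: X] !=set0, inputs S !=set0 &
      forall u, inputs S u -> strict (fun x => trans S x u)].

Definition system_solution S (u : nat -> T) (x : nat -> X) : Prop :=
  (forall t, inputs S (u t)) /\ (forall t, trans S (x t) (u t) (x t.+1)).

End systems.

(* A controller (Z, Z0, X~, U~, H) for state set X and inputs in T; the
   inclusion of X in X~ is an injection cincl. *)
Record controller (X T : Type) := Controller {
  cstate : Type ;
  cinit : set cstate ;
  cdom : Type ;
  cincl : X -> cdom ;
  cinputs : set T ;
  cmap : cstate -> cdom -> set (cstate * T * bool) }.

Arguments cinit {X T} c.
Arguments cincl {X T} c.
Arguments cinputs {X T} c.
Arguments cmap {X T} c.

Section controllers.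
Context {X T : Type}.
Implicit Types (S : system X T) (C : controller X T).

(* C belongs to the collection of all controllers for a system with state set X
   and input set U.  The state set Z is nonempty because its subset Z0 is. *)
Definition is_controller (U : set T) C : Prop :=
  [/\ cinit C !=set0, [set: cdom C] !=set0 & cinputs C !=set0] /\
  [/\ injective (cincl C), cinputs C `<=` U,
      forall z, strict (cmap C z) &
      forall z x z' u v, cmap C z x (z', u, v) -> cinputs C u].

Definition controller_solution C (u : nat -> T) (v : nat -> bool)
    (z : nat -> cstate C) (x : nat -> cdom C) : Prop :=
  [/\ forall t, cinputs C (u t), cinit C (z 0%N) &
      forall t, cmap C (z t) (x t) (z t.+1, u t, v t)].

Definition behavior C S : set ((nat -> T) * (nat -> bool) * (nat -> X)) :=
  [set b | exists z : nat -> cstate C,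
     controller_solution b.1.1 b.1.2 z (cincl C \o b.2) /\
     system_solution S b.1.1 b.2].

Definition behavior_from C S (p : X) :=
  [set b | behavior C S b /\ b.2 0%N = p].

End controllers.

Definition serial_comp {X X' T : Type} (C : controller X T)
    (Q : X' -> set (cdom C)) : controller X' T :=
  {| cstate := cstate C ; cinit := cinit C ;
     cdom := X' ; cincl := id ; cinputs := cinputs C ;
     cmap := fun z x' => \bigcup_(y in Q x') cmap C z y |}.

Arguments serial_comp {X X' T} C Q.

(* Supremum of a set of elements of [0, +oo], with sup set0 = 0; the library's
   ereal_sup set0 is -oo. *)
Definition sup_nneg {R : realType} (A : set (\bar R)) : \bar R :=
  if `[< A = set0 >] then 0%E else ereal_sup A.

Record ocp (R : realType) (X T : Type) := OCP {
  osys :> system X T ;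
  tcost : X -> \bar R ;
  rcost : X -> X -> T -> \bar R }.

Section optimal_control.
Context {R : realType} {X T : Type}.
Implicit Types (P : ocp R X T) (C : controller X T).
Local Open Scope ereal_scope.

Definition is_ocp P : Prop :=
  [/\ is_system P, forall p, 0 <= tcost P p &
      forall p q u, inputs P u -> 0 <= rcost P p q u].

Definition cost P (b : (nat -> T) * (nat -> bool) * (nat -> X)) : \bar R :=
  let: (u, v, x) := b in
  if pselect (exists t, v t) is left ex then
    let: t1 := ex_minn ex in
    tcost P (x t1) + \sum_(0 <= t < t1) rcost P (x t) (x t.+1) (u t)
  else +oo.

Definition closed_loop_value P C (p : X) : \bar R :=
  sup_nneg [set cost P b | b in behavior_from C P p].

(* The type of controllers is too large for the library's sets, hence the
   explicit existential instead of an image of a set of controllers. *)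
Definition value P (p : X) : \bar R :=
  ereal_inf [set L | exists2 C : controller X T,
    is_controller (inputs P) C & closed_loop_value P C p = L].

Definition optimal P C : Prop :=
  is_controller (inputs P) C /\ closed_loop_value P C = value P.

End optimal_control.

(* Valuated feedback refinement relation. *)
Definition vfrr {R : realType} {X1 X2 T : Type}
    (P1 : ocp R X1 T) (P2 : ocp R X2 T) (Q : X1 -> set X2) : Prop :=
  [/\ strict Q, inputs P2 `<=` inputs P1 &
      forall p1 p2 q1 q2 u, Q p1 p2 -> Q q1 q2 -> inputs P2 u ->
      [/\ (tcost P1 p1 <= tcost P2 p2)%E,
          (rcost P1 p1 q1 u <= rcost P2 p2 q2 u)%E &
          \bigcup_(q in trans P1 p1 u) Q q `<=` trans P2 p2 u]].

(* A set X2 of subsets of X1 is used as a state set through its coercion to the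
   type {W : set X1 | W \in X2}, whose elements W have underlying set \val W. *)
Definition membership {X1 : Type} (X2 : set (set X1)) : X1 -> set X2 :=
  fun p => [set W : X2 | (\val W) p].

Arguments membership {X1} X2.

(* The composition of a controller for state set X2 with the membership
   relation, the latter being seen as a map into X~ (which contains X2). *)
Definition comp_membership {X1 T : Type} {X2 : set (set X1)}
    (C : controller X2 T) : controller X1 T :=
  serial_comp C (fun p => cincl C @` membership X2 p).

Definition is_abstraction {R : realType} {X1 T : Type} {X2 : set (set X1)}
    (P1 : ocp R X1 T) (P2 : ocp R X2 T) : Prop :=
  [/\ is_ocp P1, is_ocp P2,
      X2 `<=` [set W | W !=set0],
      \bigcup_(W in X2) W = [set: X1] &
      vfrr P1 P2 (membership X2)].

Section metric_notions.
Context {R : realType} {M : metricType R}.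

Definition cball (c : M) (r : R) : set M := [set y | mdist c y <= r].

Definition proper_space : Prop := forall (c : M) (r : R), compact (cball c r).

Definition set_dist (A B : set M) : \bar R :=
  ereal_inf [set (mdist ab.1 ab.2)%:E | ab in A `*` B].

Definition diam (A : set M) : \bar R :=
  sup_nneg [set (mdist ab.1 ab.2)%:E | ab in A `*` A].

End metric_notions.

Arguments proper_space {R} M.

Section conservatism.
Context {R : realType} {X1 T : metricType R} {X2 : set (set X1)}.
Variables (P1 : ocp R X1 T) (P2 : ocp R X2 T).

(* The closed balls of (i) are those of the subspace inputs P1 of T. *)
Definition finite_conservatism (r : R) : Prop :=
  inputs P1 = inputs P1 `&` \bigcup_(u in inputs P2) cball u r /\
  forall (W W' : X2) (u : T), inputs P2 u ->
  [/\ (tcost P2 W <= r%:E + sup_nneg (tcost P1 @` \val W))%E,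
      (rcost P2 W W' u <=
         r%:E + sup_nneg [set rcost P1 p.1 p.2 u | p in \val W `*` \val W'])%E &
      (tcost P1 @` \val W) `|`
        [set rcost P1 a.1.1 a.1.2 a.2 |
           a in (\val W `*` [set: X1]) `*` inputs P1] <> [set +oo%E] ->
      trans P2 W u `<=`
        [set W'' : X2 |
           (set_dist (\val W'') (\bigcup_(p in \val W) trans P1 p u)
              <= r%:E)%E] /\
      (diam (\val W) <= r%:E)%E].

Definition abstraction_of_conservatism (rho : \bar R) : Prop :=
  [/\ is_abstraction P1 P2,
      forall W, X2 W -> closed W &
      match rho with
      | r%:E => 0 <= r /\ finite_conservatism r
      | +oo%E => True
      | -oo%E => False
      end].

End conservatism.

Section semicontinuity.
Context {R : realType}.

Definition hypo {X : Type} (f : X -> \bar R) : set (X * R) :=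
  [set xy | (xy.2%:E <= f xy.1)%E].

Definition usc {X : topologicalType} (f : X -> \bar R) : Prop :=
  closed (hypo f).

Definition set_valued_usc {A B : topologicalType} (f : A -> set B) : Prop :=
  forall W : set B, closed W -> closed [set a | f a `&` W !=set0].

(* The library's ball on X * R is the product of the balls of X and R, i.e. the
   open ball of the maximum metric. *)
Definition hypo_converges {X : metricType R} (L : nat -> X -> \bar R)
    (V : X -> \bar R) : Prop :=
  [/\ forall p, (0 <= V p)%E,
      usc V,
      forall i p, (V p <= L i p)%E &
      forall (p : X) (e : R), 0 < e ->
      exists2 N : set X, nbhs p N &
        \forall i \near \oo,
          (N `*` [set: R]) `&` hypo (L i) `<=` \bigcup_(c in hypo V) ball c e].

End semicontinuity.

(* Main.v *)
Require Import Defs.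
From mathcomp Require Import all_boot all_order all_algebra.
From mathcomp Require Import all_classical all_reals all_analysis.
From mathcomp Require Import lra.
Import Order.TTheory GRing.Theory Num.Theory.
Import numFieldNormedType.Exports.

(** Let V be the value function of the problem P, V_i that of its abstraction
Pi i, and L_i the closed-loop value function of P under the controller of Pi i
composed with membership.  The whole theorem reduces to one local upper bound
(closed_loop_value_near): if c > V(p), then for all large i the function L_i is
below c on a fixed neighbourhood of p.  Together with L_i >= V, which holds
because the composition is a controller for P, this bound yields both the upper
semicontinuity of V and the hypo-convergence.

Every closed-loop trajectory of P starting at p lifts to a closed-loop
trajectory of Pi i starting at some cell containing p, with costs that are at
least as large, so L_i(p) is at most the supremum of V_i over the cells
containing p (comp_membership_value_le).  It remains to control the upper limit
W(p) of V_i(Omega) as i tends to infinity and the cell Omega approaches p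
(upper_limit), that is, to show W <= V.

The comparison W <= V is a game argument (le_value).  Suppose that W <= G and
that every input u at every state p has a successor q with
W(p) <= g(p,q,u) + W(q).  An adversary that always selects such a successor
forces a cost of at least W(p) on every controller, since the inequalities
telescope until the controller stops, and a controller that never stops has
infinite cost.

Both hypotheses on W come from the matching upper bounds on V_i, namely
V_i <= G_i and the one-step dynamic programming inequality (value_le_step),
transferred to P by means of the conservatism conditions.  For the second one,
assume g(p,q,u) + W(q) < W(p) for all q in F(p,u).  Near each such q,
the cost of moving into a cell plus the abstract value there is at most some
constant below W(p), for all large i (step_bound_local).  Since
F(p,u) is compact, one constant c < W(p) serves a whole open neighbourhood of
F(p,u); by upper semicontinuity of F this neighbourhood also contains the
successors of nearby states under nearby inputs, hence the abstract successors
up to a small error, and so V_i <= c on all cells near p for large i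
(step_bound_abstract_bound).  This contradicts c < W(p). *)

Set Implicit Arguments.
Unset Strict Implicit.
Unset Printing Implicit Defensive.

Local Open Scope classical_set_scope.
Local Open Scope ring_scope.

(** * Bounds on the value function of an optimal control problem *)

Section values.
Context {R : realType} {X T : Type}.
Implicit Types (P : ocp R X T) (C : controller X T).
Local Open Scope ereal_scope.

Lemma cost_stop P u (v : nat -> bool) x (n : nat) :
  v n -> (forall t, (t < n)%N -> ~~ v t) ->
  cost P (u, v, x) =
    tcost P (x n) + \sum_(0 <= t < n) rcost P (x t) (x t.+1) (u t).
Proof.
move=> vn vlt; rewrite /cost; case: pselect => [ex|[]]; last by exists n.
case: ex_minnP => m vm min; suff -> : m = n by [].
apply/eqP; rewrite eqn_leq min //= leqNgt; apply/negP => /vlt.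
by rewrite vm.
Qed.

Lemma cost_nostop P u (v : nat -> bool) x :
  (forall t, ~~ v t) -> cost P (u, v, x) = +oo.
Proof.
move=> nv; rewrite /cost; case: pselect => // -[t vt].
by have := nv t; rewrite vt.
Qed.

Lemma stop_or_not (v : nat -> bool) :
  (exists2 n, v n & forall t, (t < n)%N -> ~~ v t) \/ forall t, ~~ v t.
Proof.
case: (pselect (exists t, v t)) => [ex|nex]; last first.
  by right => t; apply/negP => vt; apply: nex; exists t.
left; exists (ex_minn ex); case: ex_minnP => // m vm min t tm.
by apply/negP => /min; rewrite leqNgt tm.
Qed.

Lemma closed_loop_value_le P C p (c : \bar R) : 0 <= c ->
  (forall b, behavior_from C P p b -> cost P b <= c) ->
  closed_loop_value P C p <= c.
Proof.
move=> c0 bc; rewrite /closed_loop_value /sup_nneg.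
case: asboolP => // _; apply: ge_ereal_sup => _ [b bb <-]; exact: bc.
Qed.

Lemma cost_le_closed_loop_value P C p b :
  behavior_from C P p b -> cost P b <= closed_loop_value P C p.
Proof.
move=> bb; rewrite /closed_loop_value /sup_nneg; case: asboolP => [e|_].
  have : [set cost P b | b in behavior_from C P p] (cost P b) by exists b.
  by rewrite e.
by apply: ereal_sup_ubound; exists b.
Qed.

Lemma cost_ge0 P u v x : is_ocp P -> (forall t, inputs P (u t)) ->
  0 <= cost P (u, v, x).
Proof.
move=> [_ G0 g0] uP; have [[n vn vlt]|nv] := stop_or_not v; last first.
  by rewrite cost_nostop.
rewrite (cost_stop _ _ _ vn vlt) adde_ge0 // sume_ge0 // => t _; exact: g0.
Qed.

Lemma closed_loop_value_ge0 P C p : is_ocp P -> 0 <= closed_loop_value P C p.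
Proof.
move=> Pocp; rewrite /closed_loop_value /sup_nneg; case: asboolP => // /eqP.
move=> /set0P[_ [[[u v] x] b _]].
apply: (le_trans (cost_ge0 v x Pocp _)); last first.
  by apply: ereal_sup_ubound; exists (u, v, x); first exact: b.
by case: b => -[z [_ [+ _]]].
Qed.

Lemma value_ge0 P p : is_ocp P -> 0 <= value P p.
Proof.
move=> Pocp; apply: le_ereal_inf_tmp => _ [C _ <-].
exact: closed_loop_value_ge0.
Qed.

Lemma value_le P C p : is_controller (inputs P) C ->
  value P p <= closed_loop_value P C p.
Proof. by move=> HC; apply: ereal_inf_lbound; exists C. Qed.

Definition stopping_controller (u : T) : controller X T :=
  {| cstate := unit ; cinit := setT ; cdom := X ; cincl := id ;
     cinputs := [set u] ; cmap := fun _ _ => [set (tt, u, true)] |}.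

Lemma value_le_tcost P p : is_ocp P -> value P p <= tcost P p.
Proof.
move=> Pocp; have [[_ [u uP] _] G0 g0] := Pocp.
apply: (le_trans (value_le p (C := stopping_controller u) _)).
  split; split => //.
  - by exists tt.
  - by exists p.
  - by exists u.
  - by move=> _ ->.
  - by move=> z x; exists (tt, u, true).
  - by move=> z x z' u' v [] _ -> _.
apply: closed_loop_value_le => // -[[u' v] x] [[z [[_ _ H] _]] <-].
have [_ _ v0] := H 0%N.
by rewrite (@cost_stop _ _ _ _ 0%N) ?v0 // big_geq // adde0.
Qed.

(** The state None stands for the time before u has been applied; afterwards the
controller is a copy of C. *)
Definition delayed_controller (u : T) C : controller X T :=
  {| cstate := option (cstate C) ; cinit := [set None] ;
     cdom := cdom C ; cincl := cincl C ; cinputs := u |` cinputs C ;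
     cmap := fun z x =>
       if z is Some z1 then
         [set (Some y.1.1, y.1.2, y.2) | y in cmap C z1 x]
       else [set (Some z0, u, false) | z0 in cinit C] |}.

(** Applying u first and then running C, which is optimal from every state at
once, costs at most the running cost of the first step plus the value at the
successor. *)
Lemma value_le_step P C p u (c : \bar R) :
  is_ocp P -> optimal P C -> inputs P u ->
  (forall q, trans P p u q -> rcost P p q u + value P q <= c) ->
  value P p <= c.
Proof.
move=> Pocp [HC Copt] uP step; have [[_ _ Fs] G0 g0] := Pocp.
have c0 : 0 <= c.
  have [q pq] := Fs u uP p I; apply: le_trans (step q pq).
  by rewrite adde_ge0 ?value_ge0 ?g0.
have [[i0 d0 u0] [inj sub st cl]] := HC.
apply: (le_trans (value_le p (C := delayed_controller u C) _)).
  split; split => //.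
  - by exists None.
  - by exists u; left.
  - by move=> u' [->|/sub].
  - move=> [z|] x _ /=; first
      by have [y yz] := st z x I; exists (Some y.1.1, y.1.2, y.2), y.
    by have [z0 z00] := i0; exists (Some z0, u, false), z0.
  - move=> [z|] x z' u' v /=; last by move=> [z0 _ [_ <- _]]; left.
    by move=> [[[y1 y2] y3] /cl yu [_ <- _]]; right.
apply: closed_loop_value_le => // -[[u' v] x] [[z [[_ z0 H] [uin Ht]]] xp].
rewrite /= in z0 H uin Ht xp.
(* From time 1 on, every state of the controller is a state of C. *)
have /choice[z' Hz'] : forall t, exists s, z t.+1 = Some s.
  case=> [|t].
    by have := H 0%N; rewrite z0 => -[s _ [<- _ _]]; exists s.
  have := H t.+1; case: (z t.+1) => [s1 [[[s ?] ?] _ [<- _ _]]|[s _ [<- _ _]]];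
  by exists s.
have [u0E v0 z'0] : [/\ u' 0%N = u, v 0%N = false & cinit C (z' 0%N)].
  by have := H 0%N; rewrite z0 Hz' => -[s s0 [<- <- <-]].
have Hs t : cmap C (z' t) (cincl C (x t.+1)) (z' t.+1, u' t.+1, v t.+1).
  have := H t.+1; rewrite !Hz' => -[[[s1 s2] s3] hs [e1 e2 e3]].
  by rewrite -e1 -e2 -e3.
have bC : behavior_from C P (x 1%N) (u' \o S, v \o S, x \o S).
  split => //; exists z'; split; first split => //.
  - by move=> t; exact: cl (Hs t).
  - by split => t /=; [exact: uin | exact: Ht].
have le1 : cost P (u' \o S, v \o S, x \o S) <= value P (x 1%N).
  by rewrite -Copt; exact: cost_le_closed_loop_value.
have pq : trans P p u (x 1%N) by rewrite -xp -u0E.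
apply: le_trans (step _ pq); apply: le_trans (leeD2l _ le1).
have [[n vn vlt]|nv] := stop_or_not (v \o S); last first.
  rewrite [X in _ + X]cost_nostop // addey ?leey //.
  by rewrite gt_eqF // (lt_le_trans (ltNyr 0%R)) ?g0.
rewrite (cost_stop P (u' \o S) (x \o S) vn vlt).
rewrite (cost_stop P u' x (n := n.+1) vn); last first.
  by case=> [|t /vlt] //; rewrite v0.
by rewrite big_nat_recl //= xp u0E addeCA.
Qed.

(** The hypothesis on W provides an adversary: against any controller it selects
successors q along which W(p) <= g(p,q,u) + W(q).  These inequalities telescope,
so the cost paid up to the stopping time, plus the terminal cost, is at least W
at the initial state. *)
Lemma le_value P (W : X -> \bar R) :
  is_ocp P ->
  (forall p, W p <= tcost P p) ->
  (forall p u, inputs P u ->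
     exists2 q, trans P p u q & W p <= rcost P p q u + W q) ->
  forall p, W p <= value P p.
Proof.
move=> Pocp WG Wstep p; apply: le_ereal_inf_tmp => _ [C HC <-].
have [[[z0 z00] d0 u0] [inj sub st cl]] := HC.
have /choice[r Hr] : forall s : cstate C * X,
    exists r : (cstate C * T * bool) * X,
    [/\ cmap C s.1 (cincl C s.2) r.1, trans P s.2 r.1.1.2 r.2 &
      W s.2 <= rcost P s.2 r.2 r.1.1.2 + W r.2].
  move=> [z x] /=.
  have [[[z' u] v] H] := st z (cincl C x) I.
  have [q xq Wq] := Wstep x u (sub _ (cl _ _ _ _ _ H)).
  by exists ((z', u, v), q).
(* The closed loop of the controller and the adversary; s t is the pair of the
   controller state and the system state at time t. *)
pose s := fix s t := if t is t'.+1 then ((r (s t')).1.1.1, (r (s t')).2)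
                     else (z0, p).
pose x t := (s t).2; pose u t := (r (s t)).1.1.2; pose v t := (r (s t)).1.2.
have bC : behavior_from C P p (u, v, x).
  split => //; exists (fun t => (s t).1).
  have uC t : cinputs C (u t).
    have [+ _ _] := Hr (s t); rewrite /u; case: (r (s t)).1 => -[? ?] ?.
    exact: cl.
  split; last by split => t; [exact/sub/uC | have [_ + _] := Hr (s t)].
  split => // t /=; have [+ _ _] := Hr (s t); rewrite /u /v.
  by case: (r (s t)) => -[[? ?] ?] ?.
apply: le_trans (cost_le_closed_loop_value bC).
have Wn n : W p <= W (x n) + \sum_(0 <= t < n) rcost P (x t) (x t.+1) (u t).
  elim: n => [|n IHn]; first by rewrite big_geq // adde0.
  apply: (le_trans IHn).
  rewrite big_nat_recr //= [X in _ <= _ + X]addeC addeA leeD2r //.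
  by have [_ _] := Hr (s n); rewrite [X in _ <= X]addeC.
have [[n vn vlt]|nv] := stop_or_not v; last by rewrite cost_nostop ?leey.
by rewrite (cost_stop _ _ _ vn vlt) (le_trans (Wn n)) // leeD2r.
Qed.

End values.

(** * Transfer of closed-loop values along the membership relation *)

Section refinement.
Context {R : realType} {X T : Type} {X2 : set (set X)}.
Variables (P : ocp R X T) (P2 : ocp R X2 T) (C : controller X2 T).
Hypothesis P2_abs : is_abstraction P P2.
Hypothesis HC : is_controller (inputs P2) C.
Local Open Scope ereal_scope.

Lemma comp_membership_controller : is_controller (inputs P) (comp_membership C).
Proof.
have [[[X0 _ _] _ _] _ _ _ [Qs U21 _]] := P2_abs.
have [[[z0 z00] d0 u0] [inj sub st cl]] := HC.
split; split => //.
- by exists z0.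
- exact: subset_trans sub U21.
- move=> z x _; have [W xW] := Qs x I; have [y Hy] := st z (cincl C W) I.
  by exists y; exists (cincl C W) => //; exists W.
- by move=> z x z' u v [_ [W _ <-]] /cl.
Qed.

(** The cells that the composed controller picks along a trajectory of P form a
trajectory of the abstraction, because the membership relation maps successors
in P to successors in the abstraction, and they can only increase the costs. *)
Lemma comp_membership_value_le p (c : \bar R) : 0 <= c ->
  (forall W : X2, (\val W) p -> closed_loop_value P2 C W <= c) ->
  closed_loop_value P (comp_membership C) p <= c.
Proof.
move=> c0 Wc; have [_ P2ocp _ _ [_ _ ref]] := P2_abs.
have [_ [_ sub _ cl]] := HC.
apply: closed_loop_value_le => // -[[u v] x] [[z [[uC z0 H] [_ Ht]]] xp].
rewrite /= in uC z0 H Ht xp.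
have /choice[W HW] : forall t, exists W : X2, (\val W) (x t) /\
    cmap C (z t) (cincl C W) (z t.+1, u t, v t).
  move=> t; by have [_ [W xW <-] Hy] := H t; exists W.
have Wx t : membership X2 (x t) (W t) by have [] := HW t.
have bC : behavior_from C P2 (W 0%N) (u, v, W).
  split => //; exists z; split; first by split => // t; have [] := HW t.
  split => t /=; first exact/sub/uC.
  have [_ _] := ref _ _ _ _ _ (Wx t) (Wx t) (sub _ (uC t)).
  by apply; exists (x t.+1); [exact: Ht | exact: Wx].
apply: (le_trans _ (Wc (W 0%N) _)); last by rewrite -xp; have [] := HW 0%N.
apply: le_trans (cost_le_closed_loop_value bC).
have [[n vn vlt]|nv] := stop_or_not v; last by rewrite !cost_nostop.
rewrite !(cost_stop _ _ _ vn vlt); apply: leeD.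
  by have [] := ref _ _ _ _ _ (Wx n) (Wx n) (sub _ (uC n)).
apply: lee_sum => t _.
by have [] := ref _ _ _ _ _ (Wx t) (Wx t.+1) (sub _ (uC t)).
Qed.

End refinement.

(** * Compactness and semicontinuity *)

Section topology.
Context {R : realType}.

(** Compactness as an induction principle: a property of sets that passes to
subsets and to finite unions, and that holds locally at the points of a compact
set, holds for an open neighbourhood of that set.  Otherwise the sets whose
complement in A has such a neighbourhood would form a proper filter on A without
cluster point.  Nonemptiness of A provides the property for the empty set. *)
Lemma compact_open_ind (T : topologicalType) (A : set T) (Q : set T -> Prop) :
  compact A -> A !=set0 ->
  (forall B B', B `<=` B' -> Q B' -> Q B) ->
  (forall B B', Q B -> Q B' -> Q (B `|` B')) ->
  (forall x, A x -> exists2 O, open_nbhs x O & Q O) ->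
  exists O, [/\ open O, A `<=` O & Q O].
Proof.
move=> Acpt [a0 Aa0] Qsub Qunion Qloc.
pose D (B : set T) := exists O, [/\ open O, B `<=` O & Q O].
have D0 : D set0.
  have [ O _ QO] := Qloc _ Aa0; exists set0.
  by split; [exact: open0 | | exact: Qsub (@sub0set _ _) QO].
have Dsub B B' : B `<=` B' -> D B' -> D B.
  by move=> sB [ O [oO BO QO]]; exists O; split => //; exact: subset_trans BO.
apply: contrapT => nDA.
pose F : set_system T := [set B | D (A `\` B)].
have FF : ProperFilter F.
  split; first by rewrite /F /= setD0.
  split; rewrite /F /=.
  - by rewrite setDT.
  - move=> B B' [ O [oO BO QO]] [ O' [oO' BO' QO']]; exists (O `|` O').
    split; [exact: openU | | exact: Qunion].
    by rewrite setDIr; exact: setUSS.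
  - by move=> B B' sB; apply: Dsub; exact: setDS.
have [|x [Ax xF]] := Acpt F FF; first by rewrite /F /= setDv.
have [ O [oO Ox] QO] := Qloc _ Ax.
have [ | |y []] // := xF (~` O) O; last exact: open_nbhs_nbhs.
by exists O; split => // y [_]; rewrite /setC /= => /contrapT.
Qed.

Lemma usc_near_lt (T : topologicalType) (f : T -> \bar R) x (c : R) :
  usc f -> (f x < c%:E)%E -> \forall y \near x, (f y < c%:E)%E.
Proof.
move=> fusc fxc.
have : nbhs (x, c) (~` hypo f).
  apply: open_nbhs_nbhs; split; first exact: closed_openC.
  by rewrite /hypo /=; apply/negP; rewrite -ltNge.
move=> [[A B] /= [Ax /nbhs_singleton Bc] ABf]; apply: filterS Ax => y Ay.
by have /negP := ABf (y, c) (conj Ay Bc); rewrite -ltNge.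
Qed.

Lemma set_valued_usc_near (A B : topologicalType) (f : A -> set B) a O :
  set_valued_usc f -> open O -> f a `<=` O -> \forall b \near a, f b `<=` O.
Proof.
move=> fusc oO faO; have nO := fusc _ (open_closedC oO).
have : nbhs a (~` [set b | f b `&` ~` O !=set0]).
  apply: open_nbhs_nbhs; split; first exact: closed_openC.
  by move=> [y [/faO]].
apply: filterS => b nb y by_; apply: contrapT => nOy; apply: nb; by exists y.
Qed.

Lemma nbhs_mdist (M : metricType R) (x : M) (S : set M) : nbhs x S ->
  exists2 e : R, 0 < e & forall y, mdist x y < e -> S y.
Proof.
move=> /nbhs_ballP[e /= e0 eS]; exists e => // y xy; apply: eS.
by rewrite ballEmdist.
Qed.

Lemma nbhs_mdist2 (M N : metricType R) (x : M) (u : N) (S : set (M * N)) :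
  nbhs (x, u) S ->
  exists2 e : R, 0 < e &
    forall y v, mdist x y < e -> mdist u v < e -> S (y, v).
Proof.
move=> [[A B] /= [/nbhs_mdist[e e0 eA] /nbhs_mdist[d d0 dB]] AB].
exists (Num.min e d) => [|y v]; first by rewrite lt_min e0.
by rewrite !lt_min => /andP[/eA Ay _] /andP[_ /dB Bv]; exact: AB.
Qed.

Lemma lte_between (x y : \bar R) : (x < y)%E ->
  exists c : R, (x < c%:E)%E /\ (c%:E < y)%E.
Proof.
case: x y => [x||] [y||] // xy; rewrite ?lte_fin in xy.
- by exists ((x + y) / 2); rewrite !lte_fin !midf_lt.
- by exists (x + 1); rewrite lte_fin ltrDl ltr01 ltry.
- by exists (y - 1); rewrite ltNyr lte_fin ltrBlDr ltrDl ltr01.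
- by exists 0; rewrite ltNyr ltry.
Qed.

Lemma sup_nneg_le (A : set (\bar R)) (c : \bar R) : A !=set0 ->
  (forall x, A x -> (x <= c)%E) -> (sup_nneg A <= c)%E.
Proof.
move=> [a Aa] Ac; rewrite /sup_nneg; case: asboolP => [A0|_].
  by rewrite A0 in Aa.
exact: ge_ereal_sup.
Qed.

Lemma mdist_le_diam (M : metricType R) (A : set M) (r : R) x y :
  (diam A <= r%:E)%E -> A x -> A y -> mdist x y <= r.
Proof.
move=> + Ax Ay; rewrite -lee_fin; apply: le_trans.
have Axy : [set (mdist ab.1 ab.2)%:E | ab in A `*` A] (mdist x y)%:E.
  by exists (x, y).
rewrite /diam /sup_nneg; case: asboolP => [A0|_]; first by rewrite A0 in Axy.
exact: ereal_sup_ubound.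
Qed.

End topology.

(** * Cells of small diameter *)

Section finite_cost.
Context {R : realType} {X T : Type}.
Variable P : ocp R X T.

(** The condition under which the conservatism of an abstraction controls the
diameter and the successors of a cell. *)
Definition has_finite_cost (A : set X) : Prop :=
  (tcost P @` A) `|`
    [set rcost P a.1.1 a.1.2 a.2 | a in (A `*` [set: X]) `*` inputs P]
  <> [set +oo%E].

Lemma tcost_has_finite_cost A p :
  A p -> (tcost P p < +oo)%E -> has_finite_cost A.
Proof.
move=> Ap pfin E; have : [set +oo%E] (tcost P p) by rewrite -E; left; exists p.
by move=> /= e; rewrite e ltxx in pfin.
Qed.

Lemma rcost_has_finite_cost A p q u :
  A p -> inputs P u -> (rcost P p q u < +oo)%E -> has_finite_cost A.
Proof.
move=> Ap Pu pfin E; have : [set +oo%E] (rcost P p q u).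
  by rewrite -E; right; exists ((p, q), u).
by move=> /= e; rewrite e ltxx in pfin.
Qed.

End finite_cost.

(** * The upper limit of the abstract value functions *)

Section upper_limit.
Context {R : realType} {X U : metricType R} (P : ocp R X U).
Hypothesis P_ocp : is_ocp P.
Hypothesis P_inputs : inputs P = [set: U].
Hypothesis F_compact : forall (x : X) (u : U), compact (trans P x u).
Hypothesis g_usc : usc (fun a : X * X * U => rcost P a.1.1 a.1.2 a.2).
Hypothesis G_usc : usc (tcost P).
Hypothesis F_usc : set_valued_usc (fun a : X * U => trans P a.1 a.2).
Variables (Xi : nat -> set (set X)) (Pi : forall i : nat, ocp R (Xi i) U).
Variable rho : nat -> \bar R.
Hypothesis Pi_abs :
  forall i : nat, abstraction_of_conservatism P (Pi i) (rho i).
Variable C : forall i : nat, controller (Xi i) U.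
Hypothesis C_opt : forall i : nat, optimal (Pi i) (C i).
Hypothesis rho_cvg : rho @ \oo --> 0%E.

Lemma Pi_abstraction i : is_abstraction P (Pi i).
Proof. by have [] := Pi_abs i. Qed.

Lemma Pi_ocp i : is_ocp (Pi i).
Proof. by have [] := Pi_abstraction i. Qed.

Lemma Pi_input i : inputs (Pi i) !=set0.
Proof. by have [[_ ? _] _ _] := Pi_ocp i. Qed.

Lemma Xi_cover i p : exists W : Xi i, (\val W) p.
Proof.
have [_ _ _ cov _] := Pi_abstraction i.
have : [set: X] p by [].
rewrite -cov => -[W XW Wp]; by exists (exist _ W (mem_set XW)).
Qed.

Lemma conservatism_near (d : R) : 0 < d -> \forall i \near \oo,
  exists r, [/\ 0 <= r, r < d & finite_conservatism P (Pi i) r].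
Proof.
move=> d0; have [rfin rcvg] := (fine_cvgP _ _).1 rho_cvg.
have rlt : \forall i \near \oo, (fine \o rho) i < d := cvgr_lt _ rcvg _ d0.
near=> i; have rE : (fine (rho i))%:E = rho i.
  by rewrite fineK //; near: i; exact: rfin.
have [_ _] := Pi_abs i; rewrite -rE => -[r0 cons]; exists (fine (rho i)).
by split => //; near: i; exact: rlt.
Unshelve. all: end_near.
Qed.

(** The diameter bound of the conservatism is attached to the choice of an input;
any input serves, and there is one. *)
Lemma conservatism_diam i r (W : Xi i) x y : finite_conservatism P (Pi i) r ->
  has_finite_cost P (\val W) -> (\val W) x -> (\val W) y -> mdist x y <= r.
Proof.
move=> [_ cons] fW Wx Wy; have [u uP] := Pi_input i.
have [_ _ /(_ fW)[_ dW]] := cons W W u uP.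
exact: mdist_le_diam dW Wx Wy.
Qed.

(** The finite-cost clause is carried along because it is what makes a cell close
to p small, hence entirely close to p. *)
Definition abstract_bound (p : X) (c : R) : Prop :=
  exists2 e : R, 0 < e & \forall i \near \oo, forall W : Xi i,
    (exists2 q, mdist p q < e & (\val W) q) ->
    has_finite_cost P (\val W) /\ (value (Pi i) W <= c%:E)%E.

(** The limit superior of the value of Pi i at W, as i tends to infinity and the
cell W approaches p. *)
Definition upper_limit (p : X) : \bar R :=
  ereal_inf [set c%:E | c in abstract_bound p].

Lemma upper_limit_lt p (c : \bar R) : (upper_limit p < c)%E ->
  exists2 c', abstract_bound p c' & (c'%:E < c)%E.
Proof. by move=> /ereal_inf_lt[_ [c' bc' <-] c'c]; exists c'. Qed.

Lemma upper_limit_le p c : abstract_bound p c -> (upper_limit p <= c%:E)%E.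
Proof. by move=> bc; apply: ereal_inf_lbound; exists c. Qed.

Lemma upper_limit_ge0 p : (0 <= upper_limit p)%E.
Proof.
apply: le_ereal_inf_tmp => _ [c [e e0 /filter_ex[i bc]] <-].
have [W Wp] := Xi_cover i p.
have [|_] := bc W; first by exists p => //; rewrite mdistxx.
by apply: le_trans; apply: value_ge0; exact: Pi_ocp.
Qed.

(** If G(p) < c1 < c, then G < c1 on a ball around p.  A cell meeting a smaller
ball thus has a finite cost, hence a small diameter, and lies in the larger ball,
so its abstract terminal cost is at most rho_i + c1, which is below c for
large i. *)
Lemma upper_limit_le_tcost p : (upper_limit p <= tcost P p)%E.
Proof.
rewrite leNgt; apply/negP => /lte_between[c1 [Gc1 /lte_between[c [c1c]]]].
rewrite ltNge => /negP; apply; apply: upper_limit_le.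
have [e e0 eG] := nbhs_mdist (usc_near_lt G_usc Gc1).
rewrite lte_fin in c1c.
exists (e / 2); first by lra.
have d0 : 0 < Num.min (e / 2) (c - c1).
  by rewrite lt_min; apply/andP; split; lra.
apply: filterS (conservatism_near d0) => i [r [r0 + cons]] W [q pq Wq].
rewrite lt_min => /andP[re rc].
have fW : has_finite_cost P (\val W).
  by apply: (tcost_has_finite_cost Wq); apply: (lt_trans (eG _ _));
     rewrite ?ltry //; lra.
split => //; apply: le_trans (value_le_tcost _ (Pi_ocp i)) _.
have [u uP] := Pi_input i; have [/le_trans GW _ _] := cons.2 W W u uP.
apply: GW; apply: (@le_trans _ _ (r%:E + c1%:E)%E); last first.
  by rewrite -EFinD lee_fin; lra.
apply: leeD2l; apply: sup_nneg_le; first by exists (tcost P q), q.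
move=> _ [x Wx <-]; apply/ltW/eG.
have := conservatism_diam cons fW Wq Wx.
have := metric_triangle p q x; lra.
Qed.

(** Entering a cell close to O from a state close to p with an input close to u
leaves a total cost of at most c.  The number a bounds the running cost with a
margin e, which absorbs the conservatism in the abstract running cost, and b
bounds the cost-to-go. *)
Definition step_bound p u c (O : set X) : Prop :=
  exists2 e : R, 0 < e & \forall i \near \oo, forall W : Xi i,
    (exists q q', [/\ O q, mdist q q' < e & (\val W) q']) ->
    has_finite_cost P (\val W) /\
    exists a b : R, [/\ a + b <= c, (value (Pi i) W <= b%:E)%E &
      forall p' u' q', mdist p p' < e -> mdist u u' < e -> (\val W) q' ->
        (rcost P p' q' u' + e%:E <= a%:E)%E].

Lemma step_bound_sub p u c O O' :
  O `<=` O' -> step_bound p u c O' -> step_bound p u c O.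
Proof.
move=> sO [e e0 He]; exists e => //; apply: filterS He => i He W.
move=> [q [q' [Oq qq' Wq']]]; apply: He; exists q, q'.
by split => //; exact: sO.
Qed.

Lemma step_boundU p u c c' O O' : step_bound p u c O -> step_bound p u c' O' ->
  step_bound p u (Num.max c c') (O `|` O').
Proof.
move=> [e e0 He] [e' e0' He'].
exists (Num.min e e'); first by rewrite lt_min e0.
apply: (filterS2 _ _ He He') => i {}He {}He' W [q [q' [[Oq|O'q]]]].
- rewrite lt_min => /andP[qe _] Wq'.
  have [|fW [a [b [abc Wb Ha]]]] := He W; first by exists q, q'.
  split => //; exists a, b; split => //; first by rewrite le_max abc.
  move=> p1 u1 q1; rewrite !lt_min => /andP[pe _] /andP[ue _] Wq1.
  apply: le_trans (Ha p1 u1 q1 pe ue Wq1); apply: leeD2l.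
  by rewrite lee_fin ge_min lexx.
- rewrite lt_min => /andP[_ qe'] Wq'.
  have [|fW [a [b [abc Wb Ha]]]] := He' W; first by exists q, q'.
  split => //; exists a, b; split => //; first by rewrite le_max abc orbT.
  move=> p1 u1 q1; rewrite !lt_min => /andP[_ pe] /andP[_ ue] Wq1.
  apply: le_trans (Ha p1 u1 q1 pe ue Wq1); apply: leeD2l.
  by rewrite lee_fin ge_min lexx orbT.
Qed.

(** For i large some input u' of Pi i is close to u, and every abstract successor
of a cell near p under u' is close to a point of F(p'',u') with p'' near p; by
upper semicontinuity this point lies in O.  The dynamic programming inequality
with u' then bounds the abstract value by c. *)
Lemma step_bound_abstract_bound p u c O : open O -> trans P p u `<=` O ->
  step_bound p u c O -> abstract_bound p c.
Proof.
move=> oO FO [e e0 He].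
have [d d0 HF] := nbhs_mdist2 (set_valued_usc_near (a := (p, u)) F_usc oO FO).
have [[_ _ Fs] _ _] := P_ocp.
have [q0 Fq0] : trans P p u !=set0 by apply: Fs => //; rewrite P_inputs.
pose m := Num.min e d / 2; have m0 : 0 < m by rewrite divr_gt0 // lt_min e0.
have [me md] : 2 * m <= e /\ 2 * m <= d.
  by rewrite /m mulrCA divff ?mulr1 ?ge_min ?lexx ?orbT.
exists m => //.
apply: (filterS2 _ _ He (conservatism_near m0)) => i {}He [r [r0 rm cons]].
move=> W [q pq Wq].
(* A finite running cost out of W: the one towards any q0 in F(p,u), bounded in
   the hypothesis applied to a cell containing q0. *)
have fW : has_finite_cost P (\val W).
  have [W0 Wq0] := Xi_cover i q0.
  have [|_ [a [b [_ _ Ha]]]] := He W0.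
    by exists q0, q0; split => //; [exact: FO | rewrite mdistxx].
  apply: (@rcost_has_finite_cost _ _ _ _ _ q q0 u Wq).
    by rewrite P_inputs.
  have := Ha q u q0; rewrite mdistxx => /(_ _ _ Wq0) H.
  have {H} : (rcost P q q0 u + e%:E <= a%:E)%E by apply: H => //; lra.
  by case: (rcost P q q0 u) => [x||] //= _; rewrite ltry.
split => //.
have [u' uu' Pu'] : exists2 u', mdist u u' <= r & inputs (Pi i) u'.
  have : inputs P u by rewrite P_inputs.
  by rewrite cons.1 => -[_ [u' Pu']]; rewrite /cball /= metric_sym; exists u'.
apply: (value_le_step (u := u') (Pi_ocp i) (C_opt i)) => // W' WW'.
have [_ gW /(_ fW)[FW _]] := cons.2 W W' u' Pu'.
have /ereal_inf_lt[_ [[q' q''] /= [W'q' [p'' Wp'' Fq'']] <-]] :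
    (set_dist (\val W') (\bigcup_(x in \val W) trans P x u') < m%:E)%E.
  by apply: le_lt_trans (FW _ WW') _; rewrite lte_fin.
rewrite lte_fin metric_sym => q'q''.
have Wp x : (\val W) x -> mdist p x < 2 * m.
  move=> Wx; have := conservatism_diam cons fW Wq Wx.
  have := metric_triangle p q x; lra.
have [|_ [a [b [abc Vb Ha]]]] := He W'.
  exists q'', q'; split => //; last by lra.
  apply: HF Fq''; last by lra.
  by have := Wp _ Wp''; lra.
apply: (@le_trans _ _ (a%:E + b%:E)%E); last by rewrite -EFinD lee_fin.
apply: leeD => //; apply: (le_trans gW).
apply: (@le_trans _ _ (r%:E + (a - e)%:E)%E); last first.
  by rewrite -EFinD lee_fin; lra.
apply: leeD2l; apply: sup_nneg_le.
  by exists (rcost P q q' u'), (q, q').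
move=> _ [[x y] /= [Wx W'y] <-]; rewrite EFinB leeBrDr //.
by apply: Ha => //; have := Wp _ Wx; lra.
Qed.

(** Both terms on the left are finite.  The gap to upper_limit p is cut into three
equal parts: one for the oscillation of g near (p,q,u), one for the margin in the
running cost, and one for the excess of the abstract cost-to-go over
upper_limit q. *)
Lemma step_bound_local p q u :
  (rcost P p q u + upper_limit q < upper_limit p)%E ->
  exists2 O, open_nbhs q O &
    exists2 c : R, (c%:E < upper_limit p)%E & step_bound p u c O.
Proof.
move=> lt_p; have [_ _ g0] := P_ocp.
have : (0 <= rcost P p q u)%E by apply: g0; rewrite P_inputs.
have := upper_limit_ge0 q.
case rE : (rcost P p q u) lt_p => [x||] //; last first.
  by case: (upper_limit q) => [w||] //; rewrite addye // ltNge leey.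
case wE : (upper_limit q) => [w||] //; last by rewrite addey // ltNge leey.
move=> /lte_between[c [+ cp]] _ _; rewrite -EFinD lte_fin => xwc.
pose t := (c - x - w) / 3.
have [t0 ct] : 0 < t /\ c = x + w + 3 * t by rewrite /t; split; lra.
have [b bq bw] : exists2 b, abstract_bound q b & (b%:E < (w + t)%:E)%E.
  by apply: upper_limit_lt; rewrite wE lte_fin; lra.
rewrite lte_fin in bw; have [e1 e10 He1] := bq.
have gx : (rcost P (p, q, u).1.1 (p, q, u).1.2 (p, q, u).2 < (x + t)%:E)%E.
  by rewrite /= rE lte_fin; lra.
have [[A B] /= [Apq Bu] ABg] := usc_near_lt g_usc gx.
have [e2 e20 eA] := nbhs_mdist2 Apq.
have [e3 e30 eB] := nbhs_mdist Bu.
(* A point of the cell is within 3 * e of q: e to the neighbourhood's point,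
   e from there to the cell, and e for the diameter of the cell. *)
pose e := Num.min (Num.min e1 e2) (Num.min e3 t) / 3.
have e0 : 0 < e by rewrite divr_gt0 // !lt_min e10 e20 e30 t0.
have /and4P[ee1 ee2 ee3 et] :
    [&& 3 * e <= e1, 3 * e <= e2, 3 * e <= e3 & 3 * e <= t].
  by rewrite /e mulrCA divff // mulr1 !ge_min !lexx ?orbT.
exists (ball q e)^°.
  by split; [exact: open_interior | exact: nbhsx_ballx].
exists c => //; exists e => //.
apply: (filterS2 _ _ He1 (conservatism_near e0)) => i {}He1 [r [r0 re cons]] W.
move=> [q1 [q2 [/interior_subset]]]; rewrite ballEmdist /= => qq1 q12 Wq2.
have qq2 := metric_triangle q q1 q2.
have [|fW Wb] := He1 W; first by exists q2 => //; lra.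
split => //; exists (x + 2 * t), b; split => //; first by lra.
move=> p' u' q' pp' uu' Wq'.
have q2q' := conservatism_diam cons fW Wq2 Wq'.
have qq' := metric_triangle q q2 q'.
have g'lt : (rcost P p' q' u' < (x + t)%:E)%E.
  apply: (ABg ((p', q'), u')); split => /=; [apply: eA | apply: eB]; lra.
apply: (@le_trans _ _ ((x + t)%:E + e%:E)%E); first by rewrite leeD2r // ltW.
by rewrite -EFinD lee_fin; lra.
Qed.

(** Were every successor strictly better, compactness of F(p,u) would give a
single constant below upper_limit p that is an abstract bound at p. *)
Lemma upper_limit_step p u :
  exists2 q, trans P p u q & (upper_limit p <= rcost P p q u + upper_limit q)%E.
Proof.
apply: contrapT => nq.
have [[_ _ Fs] _ _] := P_ocp.
have Fpu : trans P p u !=set0 by apply: Fs => //; rewrite P_inputs.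
have [ | | | O [oO FO [c cp bc]]] := @compact_open_ind _ _
  (fun O => exists2 c : R, (c%:E < upper_limit p)%E & step_bound p u c O)
  (@F_compact p u) Fpu.
- by move=> B B' sB [c cp bc]; exists c => //; exact: step_bound_sub bc.
- move=> B B' [c cp bc] [c' cp' bc']; exists (Num.max c c').
    by rewrite EFin_max gt_max cp.
  exact: step_boundU.
- move=> q Fq; apply: step_bound_local.
  by rewrite ltNge; apply/negP => ?; apply: nq; exists q.
have := upper_limit_le (step_bound_abstract_bound oO FO bc).
by rewrite leNgt cp.
Qed.

Lemma upper_limit_le_value p : (upper_limit p <= value P p)%E.
Proof.
apply: le_value => //; first exact: upper_limit_le_tcost.
by move=> q u _; exact: upper_limit_step.
Qed.

Lemma closed_loop_value_near p (c : \bar R) : (value P p < c)%E ->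
  exists2 c' : R, (c'%:E < c)%E & exists2 e : R, 0 < e &
    \forall i \near \oo, forall q, mdist p q < e ->
      (closed_loop_value P (comp_membership (C i)) q <= c'%:E)%E.
Proof.
move=> /(le_lt_trans (upper_limit_le_value p))/upper_limit_lt[c' [e e0 He] c'c].
exists c' => //; exists e => //; apply: filterS He => i {}He q pq.
have [Ci Ciopt] := C_opt i.
apply: (comp_membership_value_le (Pi_abstraction i) Ci).
  have [W Wq] := Xi_cover i q; have [|_] := He W; first by exists q.
  by apply: le_trans; exact: value_ge0 (Pi_ocp i).
by move=> W Wq; rewrite Ciopt; have [|_] := He W; first by exists q.
Qed.

Lemma value_le_closed_loop i p :
  (value P p <= closed_loop_value P (comp_membership (C i)) p)%E.
Proof.
apply: value_le; apply: comp_membership_controller (Pi_abstraction i) _.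
by have [] := C_opt i.
Qed.

(** A bound of some L_i below y near p also bounds the value function below y
there, since the latter is at most L_i. *)
Lemma value_usc : usc (value P).
Proof.
rewrite /usc -[hypo _]setCK; apply: open_closedC; rewrite openE => -[p y] /=.
rewrite /hypo /= => /negP; rewrite -ltNge.
move=> /closed_loop_value_near[c cy [e e0 /filter_ex[i Hi]]].
rewrite lte_fin in cy.
exists (ball p e, [set z | c < z]); first split => /=.
- exact: nbhsx_ballx.
- exact: lt_nbhsr.
move=> [q z] /= [+ cz]; rewrite ballEmdist /= => pq; apply/negP; rewrite -ltNge.
by rewrite (le_lt_trans (value_le_closed_loop i q)) // (le_lt_trans (Hi q pq)).
Qed.

End upper_limit.

(** * Hypo-convergence *)

Theorem mainTheorem10 (R : realType) (X U : metricType R) (P : ocp R X U)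
    (P_ocp : is_ocp P)
    (P_inputs : inputs P = [set: U])
    (X_proper : proper_space X)
    (U_compact : compact [set: U])
    (F_compact : forall (x : X) (u : U), compact (trans P x u))
    (g_usc : usc (fun a : X * X * U => rcost P a.1.1 a.1.2 a.2))
    (G_usc : usc (tcost P))
    (F_usc : set_valued_usc (fun a : X * U => trans P a.1 a.2))
    (Xi : nat -> set (set X))
    (Pi : forall i : nat, ocp R (Xi i) U)
    (rho : nat -> \bar R)
    (Pi_abs : forall i : nat, abstraction_of_conservatism P (Pi i) (rho i))
    (C : forall i : nat, controller (Xi i) U)
    (C_opt : forall i : nat, optimal (Pi i) (C i))
    (rho_cvg : rho @ \oo --> 0%E) :
  hypo_converges
    (fun i : nat => closed_loop_value P (comp_membership (C i))) (value P).
Proof.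
split.
- by move=> p; exact: value_ge0.
- exact: (value_usc P_ocp P_inputs F_compact g_usc G_usc F_usc Pi_abs
    C_opt rho_cvg).
- exact: (value_le_closed_loop Pi_abs C_opt).
move=> p e e0.
have := leey (value P p); rewrite le_eqVlt => /orP[/eqP Vp|Vp].
  exists (ball p e); first exact: nbhsx_ballx.
  apply: nearW => i [q y] [[/= pq _] _].
  exists (p, y); first by rewrite /hypo /= Vp leey.
  by split => //=; exact: ballxx.
have Vfin : value P p = (fine (value P p))%:E.
  by rewrite fineK // ge0_fin_numE // value_ge0.
have Vlt : (value P p < (fine (value P p) + e)%:E)%E.
  by rewrite [X in (X < _)%E]Vfin lte_fin ltrDl.
have [c cV [d d0 Hd]] := closed_loop_value_near P_ocp P_inputs F_compact g_usc
  G_usc F_usc Pi_abs C_opt rho_cvg Vlt.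
rewrite lte_fin in cV.
have m0 : 0 < Num.min d e by rewrite lt_min d0.
exists (ball p (Num.min d e)); first exact: nbhsx_ballx.
apply: filterS Hd => i {}Hd [q y] [[+ _]].
rewrite /= ballEmdist /= lt_min => /andP[pd pe].
rewrite /hypo /= => /le_trans/(_ (Hd q pd)); rewrite lee_fin => yc.
exists (p, Num.min y (fine (value P p))).
  by rewrite /hypo /= [X in (_ <= X)%E]Vfin lee_fin ge_min lexx orbT.
split => /=; first by rewrite ballEmdist.
rewrite /ball /= ltr_norml; case: (leP y (fine (value P p))) => yV;
  by apply/andP; split; lra.
Qed.
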